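(* Let $(\mathcal{P},\leq)$ be a locally finite poset, let $x\in\mathcal{P}$ and let $\mathcal{P}_x=\{y\in\mathcal{P}\mid x\leq y\}$. Then $(\mathcal{P}_x,\leq)$ is order isomorphic to $(\mathcal{S},\leq_{\mathcal{S}})$ for some $m$ and some pointed semigroup $\mathcal{S}\subset\mathbb{Z}^m$ if and only if $l_1(x)$ is finite and $\mathcal{P}_x$ is autoequivalent, with a family of isomorphisms $\{g_y\}_{y\in\mathcal{P}_x}$ whose associated subgroup $L_{\mathcal{P}}\subset\mathbb{Z}^n$ (where $n=|l_1(x)|$) satisfies $L_{\mathcal{P}}=\mathrm{Sat}(L_{\mathcal{P}})$.
   Context: $\mathbb{N}=\{0,1,2,\ldots\}$. A poset is locally finite if all its intervals are finite. A semigroup $\mathcal{S}\subset\mathbb{Z}^m$ here means a set of the form $\langle a_1,\ldots,a_r\rangle=\{x_1a_1+\cdots+x_ra_r\mid x_i\in\mathbb{N}\}$ with $a_1,\ldots,a_r\in\mathbb{Z}^m$ nonzero ($r\geq0$, with $\mathcal{S}=\{0\}$ if $r=0$); it is pointed if $\mathcal{S}\cap(-\mathcal{S})=\{0\}$, and then it is partially ordered by $u\leq_{\mathcal{S}}v\iff v-u\in\mathcal{S}$. An order isomorphism is an order preserving and order reflecting bijection. For $y\in\mathcal{P}$, $\mathcal{P}_y:=\{z\in\mathcal{P}\mid y\leq z\}$, and $l_1(y)$ is the set of elements covering $y$: $l_1(y)=\{z\in\mathcal{P}\mid y<z$ and there is no $u\in\mathcal{P}$ with $y<u<z\}$. $\mathcal{P}_x$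 is autoequivalent if for every $y\in\mathcal{P}_x$ there is an order isomorphism $g_y:\mathcal{P}_x\to\mathcal{P}_y$ such that $g_y\circ g_z=g_z\circ g_y$ for all $y,z\in\mathcal{P}_x$ (each $g_y$ being viewed as a map $\mathcal{P}_x\to\mathcal{P}_x$, since $\mathcal{P}_y\subset\mathcal{P}_x$) and $g_x$ is the identity. Given such a family $\{g_y\}$ and assuming $l_1(x)=\{x_1,\ldots,x_n\}$ is finite with $n$ elements, let $f:\mathbb{N}^n\to\mathcal{P}_x$ be the (well-defined) map determined by $f(0)=x$ and $f(\alpha+e_i)=g_{x_i}(f(\alpha))$ for all $\alpha\in\mathbb{N}^n$ and $i\in\{1,\ldots,n\}$, where $e_1,\ldots,e_n$ is the canonical basis. The associated subgroup is $L_{\mathcal{P}}:=\{\alpha-\beta\in\mathbb{Z}^n\mid\alpha,\beta\in\mathbb{N}^n,\ f(\alpha)=f(\beta)\}$. For a subgroup $L\subset\mathbb{Z}^n$, its saturation is $\mathrm{Sat}(L):=\{\gamma\in\mathbb{Z}^n\mid d\gamma\in L\text{ for some integer }d\geq1\}$. *)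

(* Defs.v *)
From mathcomp Require Import all_boot all_order all_algebra.
From mathcomp Require Import boolp classical_sets functions cardinality.

Set Implicit Arguments.
Unset Strict Implicit.
Unset Printing Implicit Defensive.

Import Order.TTheory GRing.Theory Num.Theory.
Local Open Scope classical_set_scope.
Local Open Scope ring_scope.

(* The order relations are arguments because [le_semigroup S] below depends on
   [S] and so is not a canonical order on the carrier. *)
Definition order_iso (T U : Type) (leT : T -> T -> Prop) (leU : U -> U -> Prop)
    (A : set T) (B : set U) (f : T -> U) : Prop :=
  set_bij A B f /\
  (forall a b : T, A a -> A b -> (leT a b <-> leU (f a) (f b))).

Section Posets.
Context (d : Order.disp_t) (P : porderType d).
Local Open Scope order_scope.

Definition locally_finite : Prop :=
  forall a b : P, finite_set [set u : P | a <= u <= b].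

Definition le_poset (u v : P) : Prop := u <= v.

Definition upset (x : P) : set P := [set y | x <= y].

Definition l1 (y : P) : set P :=
  [set z | y < z /\ ~ exists u : P, y < u /\ u < z].

(* [g y] is a total function on [P], but only [g y z] with [y] and [z] in
   [upset x] is constrained. *)
Definition autoequivalence (x : P) (g : P -> P -> P) : Prop :=
  [/\ forall y, upset x y ->
        order_iso le_poset le_poset (upset x) (upset y) (g y),
      forall y z, upset x y -> upset x z ->
        forall u, upset x u -> g y (g z u) = g z (g y u)
    & forall u, upset x u -> g x u = u].

(* These equations determine [f]; it exists because the [g y] commute. *)
Definition is_parametrization (x : P) (g : P -> P -> P) (n : nat)
    (xs : 'I_n -> P) (f : 'rV[nat]_n -> P) : Prop :=
  f 0%R = x /\
  (forall (alpha : 'rV[nat]_n) (i : 'I_n),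
     f (alpha + delta_mx 0 i)%R = g (xs i) (f alpha)).

Definition assoc_subgroup (n : nat) (f : 'rV[nat]_n -> P) : set 'rV[int]_n :=
  [set gamma | exists alpha beta : 'rV[nat]_n,
     gamma = (map_mx Posz alpha - map_mx Posz beta)%R /\ f alpha = f beta].

End Posets.

Definition Sat (n : nat) (L : set 'rV[int]_n) : set 'rV[int]_n :=
  [set gamma | exists k : int, 1 <= k /\ L (k *: gamma)].

Definition is_semigroup (m : nat) (S : set 'rV[int]_m) : Prop :=
  exists (r : nat) (a : 'I_r -> 'rV[int]_m),
    (forall i, a i != 0) /\
    S = [set v | exists c : 'I_r -> nat, v = \sum_(i < r) a i *+ c i].

Definition pointed (m : nat) (S : set 'rV[int]_m) : Prop :=
  S `&` [set - v | v in S] = [set 0].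

Definition le_semigroup (m : nat) (S : set 'rV[int]_m) (u v : 'rV[int]_m) :
  Prop := S (v - u).

Arguments locally_finite {d} P.

(* Main.v *)
(** A semigroup isomorphism [phi] turns the translations [v |-> phi y + v] into
    the maps [g y], the atoms of [S] are among its generators, and [L] is the
    kernel of a homomorphism into a torsion-free group, hence saturated.
    Conversely, [f (alpha + gamma)] is the image of [f alpha] under an
    isomorphism from [upset x] to [upset (f gamma)]; so [L] is a subgroup whose
    cosets are the fibres of [f], and [f alpha <= f beta] iff [f beta] is
    [f (alpha + gamma)] for some [gamma].  A saturated [L] is the kernel of an
    integer matrix [A], and [f alpha |-> alpha *m A] is the isomorphism. *)
Require Import Defs.
From mathcomp Require Import all_boot all_order all_algebra.
From mathcomp Require Import boolp classical_sets functions cardinality.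

Set Implicit Arguments.
Unset Strict Implicit.
Unset Printing Implicit Defensive.

Import Order.TTheory GRing.Theory Num.Theory.
Local Open Scope classical_set_scope.
Local Open Scope ring_scope.

(** * Extremal elements of finite intervals, and induction on natural vectors *)

Lemma seq_maximal (T : eqType) (r : rel T) (s : seq T) (a : T) :
    irreflexive r -> transitive r -> a \in s ->
  exists2 b, b \in s & {in s, forall c, ~~ r b c}.
Proof.
move=> rirr rtr; have [k] := ubnP (size s); elim: k s a => // k IHk s a sk sa.
(* If some [c] lies above [a], the elements above [a] form a shorter list, as [a] drops out. By
   transitivity a maximal element of that list is maximal in [s]. *)
have [/hasP[c sc rac]|/hasPn nor] := boolP (has (r a) s); last by exists a.
have [||b] := IHk [seq u <- s | r a u] c.
- rewrite (leq_trans _ (_ : size s <= k)%N) // size_filter.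
  rewrite -(count_predC (r a)) -addn1 leq_add2l -has_count.
  by apply/hasP; exists a; rewrite //= rirr.
- by rewrite mem_filter rac.
rewrite mem_filter => /andP[rab sb] bmax; exists b => // u su.
apply/negP => rbu; have := bmax u.
by rewrite mem_filter su (rtr _ _ _ rab rbu) rbu => /(_ isT).
Qed.

Lemma finite_interval_maximal (d : Order.disp_t) (P : porderType d)
    (hP : locally_finite P) (a b u : P) (A : set P) : (a <= u <= b)%O -> A u ->
  exists2 m, (a <= m <= b)%O & A m /\
    forall c, (a <= c <= b)%O -> A c -> ~~ (m < c)%O.
Proof.
move=> aub Au; have /finite_seqP[s sE] := hP a b.
have memE c : (c \in s) = (a <= c <= b)%O.
  by apply/idP/idP => [cs|cab];
    [have : [set` s] c by [] | have : [set c : P | a <= c <= b]%O c by []];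
    rewrite ?sE // -sE.
have [|||m] := @seq_maximal P <%O [seq c <- s | `[< A c >]] u.
- by move=> c; exact: ltxx.
- by move=> p q w; exact: lt_trans.
- by rewrite mem_filter memE aub andbT; apply/asboolP.
rewrite mem_filter memE => /andP[/asboolP Am mab] mmax.
exists m => //; split=> // c cab Ac; apply: mmax.
by rewrite mem_filter memE cab andbT; apply/asboolP.
Qed.

Lemma finite_interval_minimal (d : Order.disp_t) (P : porderType d)
    (hP : locally_finite P) (a b u : P) (A : set P) : (a <= u <= b)%O -> A u ->
  exists2 m, (a <= m <= b)%O & A m /\
    forall c, (a <= c <= b)%O -> A c -> ~~ (c < m)%O.
Proof.
move=> aub Au; have hd : locally_finite P^d.
  by move=> p q; apply: sub_finite_set (hP q p) => w /=; rewrite andbC.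
have [|//|m mab [Am mmax]] := @finite_interval_maximal _ P^d hd b a u A.
  by rewrite andbC.
exists m; first by rewrite andbC.
by split=> // c cab; apply: mmax; rewrite andbC.
Qed.

Lemma natvec_ind n (Q : 'rV[nat]_n -> Prop) : Q 0 ->
  (forall alpha i, Q alpha -> Q (alpha + delta_mx 0 i)) -> forall alpha, Q alpha.
Proof.
move=> Q0 QS alpha; rewrite [alpha]row_sum_delta.
elim/big_rec: _ => // i beta _ Qbeta.
elim: (alpha 0 i) => [|k IHk]; first by rewrite scale0r add0r.
rewrite -[k.+1]addn1 scalerDl scale1r -addrA [delta_mx _ _ + _]addrC addrA.
exact: QS.
Qed.

(** * Saturated subgroups as kernels of integer matrices *)

Lemma clear_denominators m n (A : 'M[rat]_(m, n)) :
  exists (k : int) (B : 'M[int]_(m, n)),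
    0 < k /\ map_mx intr B = k%:~R *: A.
Proof.
(* The product of all denominators is a common multiple; entry [(i, j)] of the integer matrix omits
   its own denominator from the product. *)
exists (\prod_(p : 'I_m * 'I_n) denq (A p.1 p.2)).
exists (\matrix_(i, j) (numq (A i j) *
  \prod_(p : 'I_m * 'I_n | p != (i, j)) denq (A p.1 p.2))).
split; first by apply: prodr_gt0 => p _; apply: denq_gt0.
apply/matrixP => i j; rewrite !mxE [in RHS](bigD1 (i, j)) //= !intrM numqE.
by rewrite [A i j * _]mulrC mulrAC.
Qed.

Lemma map_mx_intr_inj m n :
  injective (map_mx intr : 'M[int]_(m, n) -> 'M[rat]_(m, n)).
Proof.
move=> A B /matrixP AB; apply/matrixP => i j.
by have := AB i j; rewrite !mxE => /intr_inj.
Qed.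

Section SaturatedSubgroup.
Context (n : nat) (L : set 'rV[int]_n).
Context (L0 : L 0) (LB : forall u v, L u -> L v -> L (u - v)).

Let LN u : L u -> L (- u). Proof. by move=> Lu; rewrite -sub0r; apply: LB. Qed.

Let LD u v : L u -> L v -> L (u + v).
Proof. by move=> Lu Lv; rewrite -[v]opprK; apply/LB/LN. Qed.

Let LZ (k : int) u : L u -> L (k *: u).
Proof.
move=> Lu; have Lnat j : L (u *+ j).
  by elim: j => [|j IHj]; rewrite ?mulr0n // mulrS; apply: LD.
rewrite -[k]intz scaler_int; case: k => j; first exact: Lnat.
by apply: LN; apply: Lnat.
Qed.

Let Lmul k (B : 'M[int]_(k, n)) (c : 'rV_k) :
  (forall i, L (row i B)) -> L (c *m B).
Proof.
by move=> LB'; rewrite mulmx_sum_row; elim/big_ind: _ => // i _; apply: LZ.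
Qed.

(** [L] is the set of integer points of a rational subspace, namely the row space of an integer
    matrix [B] with rows in [L] and largest possible rank. *)
Lemma saturated_kernel : L = Sat L ->
  exists A : 'M[int]_n, forall v, L v <-> v *m A = 0.
Proof.
move=> Lsat; pose Q r := `[< exists k (B : 'M[int]_(k, n)),
  (forall i, L (row i B)) /\ \rank (map_mx intr B : 'M[rat]_(k, n)) = r >].
have Qub r : Q r -> (r <= n)%N.
  by move=> /asboolP[k [B [_ <-]]]; apply: rank_leq_col.
have Qex : exists r, Q r.
  exists (\rank (map_mx intr (0 : 'M[int]_(0, n)) : 'M[rat]_(0, n))).
  by apply/asboolP; exists 0%N, 0; split=> // -[].
case: (ex_maxnP Qex Qub) => r /asboolP[k [B [LB' rB]]] rmax.
pose Bq : 'M[rat]_(k, n) := map_mx intr B.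
have inL v : L v <-> (map_mx intr v <= Bq)%MS.
  split=> [Lv|/submxP[c vE]].
    (* Adjoining [v] keeps all rows in [L], so by maximality the rank does not grow and [v] lies in
       the row space of [B]. *)
    have : (\rank (map_mx intr (col_mx B v) : 'M[rat]_(k + 1, n)) <= r)%N.
      apply: rmax; apply/asboolP; exists (k + 1)%N, (col_mx B v); split=> // i.
      case: (split_ordP i) => j ->; rewrite ?(rowKu, rowKd) //.
      by rewrite ord1 row_id.
    rewrite map_col_mx -rB -/Bq => rk.
    have sB : (Bq <= col_mx Bq (map_mx intr v))%MS by rewrite -addsmxE addsmxSl.
    have /eqmxP eqB : (Bq == col_mx Bq (map_mx intr v))%MS.
      by rewrite -(geq_leqif (mxrank_leqif_eq sB)).
    by rewrite eqB -addsmxE addsmxSr.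
  (* With cleared coefficients, [q *: v] is an integer combination of rows of [B], hence in [L];
     saturation then removes [q]. *)
  have [q [c' [q0 c'E]]] := clear_denominators c.
  rewrite Lsat; exists q; split=> //.
  have -> : q *: v = c' *m B; last exact: Lmul.
  apply: map_mx_intr_inj.
  by rewrite map_mxM c'E map_mxZ vE -scalemxAl.
(* [cokermx Bq] annihilates exactly the row space of [Bq], and scaling by a nonzero [q] keeps this
   kernel. *)
have [q [A [q0 AE]]] := clear_denominators (cokermx Bq).
exists A => v; rewrite inL submxE.
have qN0 : q%:~R != 0 :> rat by rewrite intr_eq0 gt_eqF.
have -> : (map_mx intr v *m cokermx Bq == 0) =
          (map_mx (intr : int -> rat) (v *m A) == 0).
  by rewrite map_mxM AE -scalemxAr scaler_eq0 (negbTE qN0).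
split=> [/eqP vA|->]; last by rewrite map_mx0.
by apply: map_mx_intr_inj; rewrite vA map_mx0.
Qed.

End SaturatedSubgroup.

(** * Order isomorphisms between upsets *)

Section UpsetIsomorphisms.
Context (d : Order.disp_t) (P : porderType d).
Local Notation upset_iso x y :=
  (order_iso (@le_poset d P) (@le_poset d P) (upset x) (upset y)).

Lemma upset_iso_le (x y : P) (G : P -> P) u v : upset_iso x y G ->
  (x <= u)%O -> (x <= v)%O -> (G u <= G v)%O = (u <= v)%O.
Proof. by move=> [_ Gle] xu xv; apply/idP/idP => /(Gle u v xu xv). Qed.

Lemma upset_iso_inj (x y : P) (G : P -> P) u v : upset_iso x y G ->
  (x <= u)%O -> (x <= v)%O -> G u = G v -> u = v.
Proof. by move=> [[_ Ginj _] _] xu xv; apply: Ginj; apply: mem_set. Qed.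

Lemma upset_iso_lt (x y : P) (G : P -> P) u v : upset_iso x y G ->
  (x <= u)%O -> (x <= v)%O -> (G u < G v)%O = (u < v)%O.
Proof.
by move=> Giso xu xv; rewrite !lt_leAnge !(upset_iso_le Giso).
Qed.

Lemma upset_iso_surj (x y : P) (G : P -> P) v : upset_iso x y G ->
  (y <= v)%O -> exists2 u, (x <= u)%O & G u = v.
Proof. by move=> [[_ _ Gsurj] _] /Gsurj [u]; exists u. Qed.

Lemma upset_iso_bottom (x y : P) (G : P -> P) : upset_iso x y G -> G x = y.
Proof.
move=> Giso; have [[Gfun _ _] _] := Giso.
have [u xu Gu] := upset_iso_surj Giso (lexx y).
apply/eqP; rewrite eq_le -{1}Gu (upset_iso_le Giso) // xu /=.
exact: (Gfun x (lexx x)).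
Qed.

(** Since [h] preserves and reflects the order, it restricts to an isomorphism from [upset y] onto
    [upset (h y)]. *)
Lemma upset_iso_comp (x y z : P) (G h : P -> P) : (x <= y)%O ->
  upset_iso x y G -> upset_iso x z h -> upset_iso x (h y) (h \o G).
Proof.
move=> xy Giso hiso; have [[Gfun _ _] _] := Giso; have [[hfun _ _] _] := hiso.
have xG u : (x <= u)%O -> (x <= G u)%O by move=> xu; apply: le_trans xy (Gfun u xu).
split; last first.
  move=> u v xu xv; rewrite /le_poset /= (upset_iso_le hiso) ?xG //.
  by rewrite (upset_iso_le Giso).
split=> [u xu|u v|w hyw].
- by rewrite /upset /= (upset_iso_le hiso) ?xG //; apply: Gfun.
- rewrite !inE => xu xv /= /(upset_iso_inj hiso (xG u xu) (xG v xv)).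
  exact: (upset_iso_inj Giso).
- have [v xv vw] := upset_iso_surj hiso (le_trans (hfun y xy) hyw).
  have yv : (y <= v)%O by rewrite -(upset_iso_le hiso) // vw.
  by have [u xu uv] := upset_iso_surj Giso yv; exists u => //=; rewrite uv.
Qed.

End UpsetIsomorphisms.

(** * The parametrization, its fibres, and the resulting semigroup *)

Section Parametrization.
Context (d : Order.disp_t) (P : porderType d) (x : P) (hP : locally_finite P).
Context (g : P -> P -> P) (n : nat) (xs : 'I_n -> P) (f : 'rV[nat]_n -> P).
Context (hg : autoequivalence x g) (hxs : set_bij [set: 'I_n] (l1 x) xs).
Context (hf : is_parametrization x g xs f).
Local Notation upset_iso x y :=
  (order_iso (@le_poset d P) (@le_poset d P) (upset x) (upset y)).

Let f0 : f 0 = x. Proof. by case: hf. Qed.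

Let xs_cover i : l1 x (xs i). Proof. by case: hxs => + _ _; apply. Qed.

Let xs_gt i : (x < xs i)%O. Proof. by case: (xs_cover i). Qed.

Let gxs_iso i : upset_iso x (xs i) (g (xs i)).
Proof. by case: hg => + _ _; apply; apply: ltW. Qed.

Let param_gex alpha : (x <= f alpha)%O.
Proof.
elim/natvec_ind: alpha => [|alpha i xf]; first by rewrite f0.
rewrite (hf.2 alpha i); have [[gfun _ _] _] := gxs_iso i.
exact: le_trans (ltW (xs_gt i)) (gfun _ xf).
Qed.

(** [G] is composed of maps [g (xs i)], one for each basis vector added. It depends on [gamma]
    alone, so relations between values of [f] can be shifted by [gamma] and back. *)
Lemma param_translation gamma :
  exists2 G, upset_iso x (f gamma) G & forall alpha, f (alpha + gamma) = G (f alpha).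
Proof.
elim/natvec_ind: gamma => [|gamma i [G Giso GE]].
  exists id; last by move=> alpha; rewrite addr0.
  by rewrite f0; split=> //; split=> // y ?; exists y.
exists (g (xs i) \o G).
  by rewrite (hf.2 gamma i); apply: upset_iso_comp Giso (gxs_iso i).
by move=> alpha; rewrite addrA (hf.2 _ i) GE.
Qed.

Lemma param_addIr alpha beta gamma :
  f (alpha + gamma) = f (beta + gamma) <-> f alpha = f beta.
Proof.
have [G Giso GE] := param_translation gamma; rewrite !GE.
by split=> [|->//]; apply: upset_iso_inj Giso _ _.
Qed.

Lemma param_delta i : f (delta_mx 0 i) = xs i.
Proof.
by rewrite -[delta_mx 0 i]add0r (hf.2 0 i) f0 (upset_iso_bottom (gxs_iso i)).
Qed.

(* A maximal value [f alpha <= y] equals [y]: otherwise a cover of [f alpha]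
   below [y] is the translate of a cover of [x], hence again a value of [f]. *)
Lemma param_surj y : (x <= y)%O -> exists alpha, f alpha = y.
Proof.
move=> xy; have [] := @finite_interval_maximal _ P hP x y x (range f).
- by rewrite lexx.
- by exists 0.
move=> u /[swap] -[[alpha _ <-] fmax] /andP[xu uy].
have [<-|neq] := eqVneq (f alpha) y; first by exists alpha.
have ltuy : (f alpha < y)%O by rewrite lt_neqAle neq.
have [] := @finite_interval_minimal _ P hP (f alpha) y y [set w | f alpha < w]%O.
- by rewrite uy lexx.
- by [].
move=> z /andP[uz zy] [/= ltuz zmin].
have [G Giso GE] := param_translation alpha.
have [w xw wz] := upset_iso_surj Giso uz.
have Gx : G x = f alpha by rewrite -f0 -GE add0r.
have wl1 : l1 x w.
  split; first by rewrite -(upset_iso_lt Giso) // wz Gx.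
  move=> [v [xv vw]].
  have Gvz : (G v < z)%O by rewrite -wz (upset_iso_lt Giso) // ltW.
  have uGv : (f alpha < G v)%O by rewrite -Gx (upset_iso_lt Giso) // ltW.
  suff : ~~ (G v < z)%O by rewrite Gvz.
  by apply: zmin => //; rewrite (ltW uGv) (le_trans (ltW Gvz) zy).
have [_ _ /(_ w wl1)[i _ iw]] := hxs.
have fz : f (delta_mx 0 i + alpha) = z by rewrite GE param_delta iw.
suff : ~~ (f alpha < z)%O by rewrite ltuz.
apply: fmax; first by rewrite zy (le_trans xu uz).
by exists (delta_mx 0 i + alpha).
Qed.

Lemma param_le alpha beta :
  (f alpha <= f beta)%O <-> exists gamma, f beta = f (alpha + gamma).
Proof.
have [G Giso GE] := param_translation alpha; split=> [leab|[gamma ->]].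
  have [w /param_surj[gamma <-] wE] := upset_iso_surj Giso leab.
  by exists gamma; rewrite addrC GE wE.
by rewrite addrC GE; have [[Gfun _ _] _] := Giso; apply: Gfun; apply: param_gex.
Qed.

(** The difference may come from another pair with [f alpha' = f beta']. Then
    [alpha + beta' = alpha' + beta], and translating and cancelling carries the equality over to
    [alpha] and [beta]. *)
Lemma param_eqP alpha beta :
  f alpha = f beta <->
  assoc_subgroup f (map_mx Posz alpha - map_mx Posz beta).
Proof.
split=> [|[alpha' [beta' [E fE]]]]; first by exists alpha, beta.
have {}E : alpha + beta' = alpha' + beta.
  apply/matrixP => i j; have /matrixP/(_ i j) := E; rewrite !mxE => /eqP.
  by rewrite subr_eq addrAC eq_sym subr_eq -!PoszD => /eqP[/esym].
rewrite -(param_addIr alpha beta beta') E [beta + _]addrC.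
exact/param_addIr.
Qed.

Lemma assoc_subgroup0 : assoc_subgroup f 0.
Proof. by exists 0, 0; rewrite subrr. Qed.

Let map_PoszD (u v : 'rV[nat]_n) :
  map_mx Posz (u + v) = map_mx Posz u + map_mx Posz v.
Proof. by apply/matrixP => i j; rewrite !mxE PoszD. Qed.

Lemma assoc_subgroupB u v :
  assoc_subgroup f u -> assoc_subgroup f v -> assoc_subgroup f (u - v).
Proof.
move=> [a [b [-> ab]]] [a' [b' [-> ab']]].
(* Translating both equalities gives [f (a + b') = f (b + b') = f (b + a')]. *)
exists (a + b'), (b + a'); split; first by rewrite !map_PoszD opprB addrACA opprD.
rewrite (param_addIr a b b').2 // ![b + _]addrC.
by apply/param_addIr.
Qed.

(** The semigroup is the image [range e] of the natural vectors under [A], generated by the rows of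
    [A]. As [e] and [f] have the same fibres, [e] factors through [f] injectively. *)
Lemma saturated_semigroup :
  assoc_subgroup f = Sat (assoc_subgroup f) ->
  exists (m : nat) (S : set 'rV[int]_m),
     [/\ is_semigroup S, pointed S
       & exists phi : P -> 'rV[int]_m,
           order_iso (@le_poset d P) (le_semigroup S) (upset x) S phi].
Proof.
move=> Lsat; have [A AE] := saturated_kernel assoc_subgroup0 assoc_subgroupB Lsat.
pose e (alpha : 'rV[nat]_n) : 'rV[int]_n := map_mx Posz alpha *m A.
have eD a b : e (a + b) = e a + e b by rewrite /e map_PoszD mulmxDl.
have e0 : e 0 = 0 by apply: (addrI (e 0)); rewrite -eD !addr0.
have eq_e a b : e a = e b <-> f a = f b.
  rewrite param_eqP AE mulmxBl -/(e a) -/(e b).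
  split=> [->|/eqP]; first by rewrite subrr.
  by rewrite subr_eq0 => /eqP.
have e_sum c : \sum_i row i A *+ c i = e (\row_i c i).
  rewrite /e mulmx_sum_row; apply: eq_bigr => i _.
  by rewrite !mxE -scaler_nat natz.
exists n, (range e); split.
- exists n, (fun i => row i A); split.
    (* A zero row would give [xs i = x], although [xs i] covers [x]. *)
    move=> i; apply/eqP => A0; have /eq_e : e (delta_mx 0 i) = e 0.
      rewrite e0 -[RHS]A0 rowE; congr (_ *m A).
      by apply/matrixP => j k; rewrite !mxE; case: (_ && _).
    by rewrite param_delta f0 => xi; have := xs_gt i; rewrite xi ltxx.
  apply/seteqP; split => [_ [a _ <-]|_ [c ->]].
    by exists (a 0); rewrite e_sum; congr e; apply/rowP => i; rewrite mxE.
  by exists (\row_i c i).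
- apply/seteqP; split => [v [[a _ <-] [_ [b _ <-] ba]]|_ ->] /=.
    (* If [e a = - e b], then [f (a + b) = x], so [f a] lies both above and below [x]. *)
    have /eq_e fab : e (a + b) = e 0 by rewrite eD e0 -ba addNr.
    have lea : (f a <= x)%O by rewrite -f0 -fab; apply/param_le; exists b.
    by rewrite -e0; apply/eq_e/le_anti; rewrite f0 lea param_gex.
  by split; [|exists 0; rewrite ?oppr0 //]; exists 0; rewrite ?e0.
(* A section [s] of [f] over [upset x], with arbitrary values elsewhere. *)
have /choice[s sE] : forall y, exists alpha, (x <= y)%O -> f alpha = y.
  move=> y; have [/param_surj[alpha]|] := boolP (x <= y)%O; first by exists alpha.
  by exists 0.
exists (e \o s); split.
  split=> [y xy|y z|_ [a _ <-]].
  - by exists (s y).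
  - by rewrite !inE => xy xz /= /eq_e; rewrite !sE.
  - by exists (f a); [exact: param_gex|]; apply/eq_e; rewrite sE.
move=> y z xy xz; rewrite /le_poset -{1}(sE y xy) -{1}(sE z xz) param_le.
split=> [[c /eq_e cE]|[c _ cE]].
  by exists c => //=; rewrite cE eD addrAC subrr add0r.
by exists c; apply/eq_e; rewrite eD cE /= addrC subrK.
Qed.

End Parametrization.

(** * Finitely generated semigroups and their atoms *)

Lemma semigroup0 m (S : set 'rV[int]_m) : is_semigroup S -> S 0.
Proof.
move=> [r [a [_ ->]]]; exists (fun=> 0%N).
by rewrite big1 // => i _; rewrite mulr0n.
Qed.

Lemma semigroupD m (S : set 'rV[int]_m) u v :
  is_semigroup S -> S u -> S v -> S (u + v).
Proof.
move=> [r [a [_ ->]]] [b ->] [c ->]; exists (fun i => b i + c i)%N.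
by rewrite -big_split; apply: eq_bigr => i _; rewrite mulrnDr.
Qed.

(* A minimal nonzero element is one of the generators. *)
Lemma semigroup_atoms_finite m (S : set 'rV[int]_m) : is_semigroup S ->
  finite_set [set v | [/\ S v, v != 0 &
    forall u, S u -> S (v - u) -> u = 0 \/ u = v]].
Proof.
move=> [r [a [aN0 ->]]]; apply: (@sub_finite_set _ _ (range a)); last first.
  exact/finite_image/finite_finset.
move=> _ [[c ->] vN0 vmin].
have [i ci] : exists i, c i != 0%N.
  apply/existsP; apply: contraNT vN0 => /existsPn c0; rewrite big1 // => i _.
  by have /negbNE/eqP -> := c0 i; rewrite mulr0n.
exists i => //; case: (vmin (a i)) => [||/eqP|//].
- exists (fun j => (j == i) : nat).
  by rewrite (bigD1 i) //= eqxx mulr1n big1 ?addr0 // => j /negbTE->.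
- exists (fun j => c j - (j == i))%N.
  rewrite (bigD1 i) // [in RHS](bigD1 i) //= eqxx.
  rewrite mulrnBr ?lt0n // mulr1n addrAC; congr (_ + _).
  by apply: eq_bigr => j /negbTE->; rewrite subn0.
- by rewrite (negbTE (aN0 i)).
Qed.

(** * Upsets isomorphic to a pointed semigroup *)

Section SemigroupUpset.
Context (d : Order.disp_t) (P : porderType d) (x : P).
Context (m : nat) (S : set 'rV[int]_m) (phi : P -> 'rV[int]_m).
Context (Ssg : is_semigroup S) (Sptd : pointed S).
Context (phi_iso : order_iso (@le_poset d P) (le_semigroup S) (upset x) S phi).

Let S0 : S 0 := semigroup0 Ssg.

Let SD u v : S u -> S v -> S (u + v). Proof. exact: semigroupD. Qed.

Let phiS y : (x <= y)%O -> S (phi y).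
Proof. by case: phi_iso => -[+ _ _] _; apply. Qed.

Let phi_inj y z : (x <= y)%O -> (x <= z)%O -> phi y = phi z -> y = z.
Proof.
by move=> xy xz; case: phi_iso => -[_ + _] _; apply; apply: mem_set.
Qed.

Let phi_le y z : (x <= y)%O -> (x <= z)%O -> (y <= z)%O <-> S (phi z - phi y).
Proof. by case: phi_iso => _; apply. Qed.

Let psi_ex : exists psi, forall s, S s -> (x <= psi s)%O /\ phi (psi s) = s.
Proof.
have /choice[psi psiE] s : exists y, S s -> (x <= y)%O /\ phi y = s.
  have [Ss|nS] := pselect (S s); last by exists x.
  by have [[_ _ /(_ s Ss)[y xy ys]] _] := phi_iso; exists y.
by exists psi.
Qed.

(** The preimage of [0] lies above [x], so [- phi x] is in [S] along with [phi x], and pointedness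
    applies. *)
Let phix : phi x = 0.
Proof.
have [psi psiE] := psi_ex; have [xz z0] := psiE 0 S0.
have Nx : S (- phi x) by rewrite -sub0r -z0; apply/phi_le.
have : (S `&` [set - v | v in S]) (phi x).
  by split; [exact: phiS | exists (- phi x); rewrite ?opprK].
by rewrite Sptd.
Qed.

Lemma semigroup_l1_finite : finite_set (l1 x).
Proof.
have [psi psiE] := psi_ex.
apply: sub_finite_set (finite_image psi (semigroup_atoms_finite Ssg)).
move=> z [xz zmin]; have xz' := ltW xz.
have psi_phi y : (x <= y)%O -> psi (phi y) = y.
  by move=> xy; have [? ?] := psiE _ (phiS xy); apply: phi_inj.
exists (phi z); last exact: psi_phi.
split; first exact: phiS.
  apply/eqP => z0; suff : z = x by move=> zx; rewrite zx ltxx in xz.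
  by apply: phi_inj; rewrite // phix z0.
(* A splitting of [phi z] into [u] and [phi z - u] within [S] places [psi u] between [x] and [z], so
   it is one of the two. *)
move=> u Su Szu; have [xu uE] := psiE u Su.
have uz : (psi u <= z)%O by apply/phi_le; rewrite // uE.
have [ux|ux] := eqVneq (psi u) x; first by left; rewrite -uE ux.
have [->|uNz] := eqVneq u (phi z); first by right.
exfalso; apply: zmin; exists (psi u); rewrite !lt_neqAle eq_sym ux xu uz.
split=> //; rewrite andbT; apply: contraNneq uNz => <-.
by rewrite uE.
Qed.

Lemma semigroup_autoequivalence :
  exists g : P -> P -> P, autoequivalence x g /\
  exists (n : nat) (xs : 'I_n -> P) (f : 'rV[nat]_n -> P),
     [/\ set_bij [set: 'I_n]%classic (l1 x) xs,
         is_parametrization x g xs f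
       & assoc_subgroup f = Sat (assoc_subgroup f)].
Proof.
have [psi psiE] := psi_ex.
have psix s : S s -> (x <= psi s)%O by case/psiE.
have psiK s : S s -> phi (psi s) = s by case/psiE.
have phiK y : (x <= y)%O -> psi (phi y) = y.
  by move=> xy; apply: phi_inj; rewrite ?psix ?psiK //; apply: phiS.
have psi_inj s t : S s -> S t -> psi s = psi t -> s = t.
  by move=> Ss St st; rewrite -(psiK s) // st psiK.
(* This is translation by [phi y], carried back along [phi]; the maps commute because addition
   does. *)
exists (fun y z => psi (phi y + phi z)); split.
  split; last by move=> u xu; rewrite phix add0r phiK.
    move=> y xy; split; last first.
      move=> a b xa xb; have SyD c : (x <= c)%O -> S (phi y + phi c).
        by move=> xc; apply: SD; apply: phiS.
      have Sa := SyD a xa; have Sb := SyD b xb.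
      rewrite /le_poset (phi_le xa xb) (phi_le (psix _ Sa) (psix _ Sb)) !psiK //.
      by rewrite opprD addrACA subrr add0r.
    split=> [z xz|z w|w yw].
    - have Syz : S (phi y + phi z) by apply: SD; apply: phiS.
      by apply/phi_le; rewrite ?psix ?psiK // addrAC subrr add0r; apply: phiS.
    - rewrite !inE => xz xw yzyw; apply: phi_inj => //; apply: (addrI (phi y)).
      by apply: psi_inj yzyw; apply: SD; apply: phiS.
    - have xw := le_trans xy yw; have Swy : S (phi w - phi y) by apply/phi_le.
      exists (psi (phi w - phi y)); first exact: psix.
      by rewrite psiK // addrC subrK phiK.
  move=> y z xy xz u xu; rewrite !psiK; try by apply: SD; apply: phiS.
  by rewrite addrCA.
have /finite_seqP[s sE] := semigroup_l1_finite.
(* Without duplicates the enumeration of the covers is injective. *)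
pose t := undup s.
have tE z : z \in t <-> l1 x z by rewrite mem_undup sE.
pose xs (i : 'I_(size t)) := tnth (in_tuple t) i.
have xs_l1 i : l1 x (xs i) by apply/tE; apply: mem_tnth.
have xxs i : (x <= xs i)%O by case: (xs_l1 i) => /ltW.
(* The homomorphism sending the basis vectors to the [phi (xs i)]; on natural vectors it is [phi]
   after the parametrization. *)
pose e (alpha : 'rV[int]_(size t)) := alpha *m \matrix_i phi (xs i).
pose en (alpha : 'rV[nat]_(size t)) := e (map_mx Posz alpha).
have enD a i : en (a + delta_mx 0 i) = phi (xs i) + en a.
  rewrite /en /e.
  have -> : map_mx Posz (a + delta_mx 0 i) = delta_mx 0 i + map_mx Posz a.
    apply/matrixP => j k; rewrite !mxE PoszD addrC; congr (_ + _).
    by case: (_ && _).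
  by rewrite mulmxDl -rowE rowK.
have en0 : en 0 = 0.
  rewrite /en /e (_ : map_mx _ _ = 0) ?mul0mx //.
  by apply/matrixP => j k; rewrite !mxE.
have enS a : S (en a).
  elim/natvec_ind: a => [|a i Sa]; rewrite ?en0 // enD.
  by apply: SD => //; apply: phiS.
exists (size t), xs, (psi \o en).
have LE gamma : assoc_subgroup (psi \o en) gamma <-> e gamma = 0.
  split=> [[a [b [-> /psi_inj ab]]]|e0].
    by rewrite /e mulmxBl -/(e _) -/(e _) -/(en a) -/(en b) ab ?subrr.
  (* Positive and negative parts of [gamma]; [Negz k] stands for the negative of [k.+1]. *)
  pose a := map_mx (fun z : int => if z is Posz k then k else 0%N) gamma.
  pose b := map_mx (fun z : int => if z is Negz k then k.+1 else 0%N) gamma.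
  exists a, b.
  have gE : gamma = map_mx Posz a - map_mx Posz b.
    apply/matrixP => i j; rewrite !mxE; case: (gamma i j) => k.
      by rewrite subr0.
    by rewrite sub0r NegzE.
  split=> //=; congr psi; apply/eqP; rewrite -subr_eq0.
  by move/eqP: e0; rewrite gE /e mulmxBl.
split.
- split=> [i _|i j _ _|z /tE zt]; first exact: xs_l1.
    by move/tuple_uniqP: (undup_uniq s : uniq (in_tuple t)); apply.
  by have /tnthP[i ->] : z \in in_tuple t by []; exists i.
- split=> [|a i] /=; first by rewrite en0 -phix phiK.
  by rewrite psiK // enD.
- apply/seteqP; split=> gamma.
    by move=> Lg; exists 1; rewrite scale1r.
  (* The target of [e] is torsion-free: the factor [k], at least 1, cancels entry by entry. *)
  move=> [k [k1 /LE kg0]]; apply/LE; move: kg0; rewrite /e -scalemxAl.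
  move: (gamma *m _) => v /matrixP kv; apply/matrixP => i j.
  have := kv i j; rewrite !mxE => /eqP; rewrite mulf_eq0 gt_eqF /=.
    by move/eqP.
  exact: lt_le_trans k1.
Qed.

End SemigroupUpset.

Theorem theorem5p5 (d : Order.disp_t) (P : porderType d) (x : P)
    (hP : locally_finite P) :
  (exists (m : nat) (S : set 'rV[int]_m),
     [/\ is_semigroup S, pointed S
       & exists phi : P -> 'rV[int]_m,
           order_iso (@le_poset d P) (le_semigroup S) (upset x) S phi])
  <->
  (finite_set (l1 x) /\
   exists g : P -> P -> P, autoequivalence x g /\
   exists (n : nat) (xs : 'I_n -> P) (f : 'rV[nat]_n -> P),
     [/\ set_bij [set: 'I_n]%classic (l1 x) xs,
         is_parametrization x g xs f
       & assoc_subgroup f = Sat (assoc_subgroup f)]).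
Proof.
split=> [[m [S [Ssg Sptd [phi phi_iso]]]]|[_ [g [hg [n [xs [f [hxs hf Lsat]]]]]]]].
  split; first exact: semigroup_l1_finite phi_iso.
  exact: semigroup_autoequivalence phi_iso.
exact (saturated_semigroup hP hg hxs hf Lsat).
Qed.
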